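(* Let $N\in\mathbb{N}$, $N\ge 1$. Let $(X_n,d_n,m_n)$ be a sequence of compact metric measure spaces which converges with respect to the distance $\mathbf{D}$ to another compact metric measure space $(X,d,m)$. If $(X_n,d_n,m_n)$ satisfies $BM(N,h_n)$ for every $n$, with $h_n\ge 0$ and $h_n\to h$ as $n\to\infty$, then $(X,d,m)$ satisfies $BM(N,h)$.
   Context: Metric measure spaces: a metric measure space is a triple $(X,d,m)$ where $(X,d)$ is a Polish metric space and $m$ is a Borel measure on $(X,d)$ with full support, i.e. $m$ charges every ball of $X$. Approximated Brunn-Minkowski inequality: let $h\ge 0$ and $N\in\mathbb{N}$, $N\ge1$. For $C_0,C_1\subset X$ and $s\in[0,1]$, the set of $h$-approximated $s$-intermediate points between $C_0$ and $C_1$ is $$C_s^h=\{x\in X : \exists (x_0,x_1)\in C_0\times C_1,\ |d(x_0,x)-s\,d(x_0,x_1)|\le h \text{ and } |d(x,x_1)-(1-s)\,d(x_0,x_1)|\le h\}.$$ The space $(X,d,m)$ satisfies $BM(N,h)$ if for all compact sets $C_0,C_1\subset X$ and all $s\in[0,1]$, $$m(C_s^h)^{1/N}\ \ge\ (1-s)\,m(C_0)^{1/N}+s\,m(C_1)^{1/N}.$$ Distance $\mathbf{D}$: for metric measure spaces $(M,d,m)$ and $(M',d',m')$, $$\mathbf{D}((M,d,m),(M',d',m'))=\inf_{\hat d,q}\left(\int_{M\times M'}\hat d^{\,2}(x,y)\,dq(x,y)\right)^{1/2},$$ where the infimum is over all pseudo-metrics $\hat d$ on the disjoint union $M\sqcup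 M'$ which coincide with $d$ on $M$ and with $d'$ on $M'$, and all couplings $q$ of the measures $m$ and $m'$ (measures on $M\times M'$ with marginals $m$ and $m'$).
   Formalization: BM(N,h) is required only for nonempty compact sets C_0, C_1 (with empty sets it never holds), and the Borel measures are assumed locally finite, i.e. finite on compact spaces, without which the claim is false; spaces are nonempty. *)

(* Defs.v *)
From HB Require Import structures.
From mathcomp Require Import all_boot all_order all_algebra.
From mathcomp Require Import all_classical all_reals all_analysis.

Set Implicit Arguments.
Unset Strict Implicit.
Unset Printing Implicit Defensive.

Import Order.TTheory GRing.Theory Num.Theory.
Import numFieldNormedType.Exports.

Local Open Scope classical_set_scope.
Local Open Scope ring_scope.

(* The point is there only because MathComp-Analysis builds the sigma-algebra
   generated by a set system on pointed types; nothing below depends on its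
   choice. *)
#[short(type="completeMetricType")]
HB.structure Definition CompleteMetric (R : numDomainType) :=
  {T of Metric R T & Complete T & Pointed T}.

Notation borel T := (g_sigma_algebraType (@open T)).

(* "Borel measure" is understood, as usual for metric measure spaces, as a
   locally finite one; on a compact space this means a finite measure. *)
Record mmspace (R : realType) := MMSpace {
  mm_carrier :> completeMetricType R ;
  mm_separable : exists2 S : set mm_carrier, countable S & dense S ;
  mm_measure : {measure set (borel mm_carrier) -> \bar R} ;
  mm_locally_finite : forall x : mm_carrier,
    exists2 r : R, 0 < r & (mm_measure (ball x r) < +oo)%E ;
  mm_full_support : forall (x : mm_carrier) (r : R),
    0 < r -> (0 < mm_measure (ball x r))%E }.

Section BrunnMinkowski.
Context {R : realType}.

Definition approx_intermediate (X : metricType R) (h s : R) (C0 C1 : set X) :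
    set X :=
  [set x | exists x0 x1, [/\ C0 x0, C1 x1,
    `|mdist x0 x - s * mdist x0 x1| <= h &
    `|mdist x x1 - (1 - s) * mdist x0 x1| <= h]].

(* Nonemptiness of C0 and C1 is implicit in any Brunn-Minkowski inequality:
   for C0 = set0, C1 = X and s = 1 the inequality would read m(X) <= 0. *)
Definition BM (X : mmspace R) (N : nat) (h : R) : Prop :=
  forall C0 C1 : set X, compact C0 -> compact C1 -> C0 !=set0 -> C1 !=set0 ->
  forall s : R, 0 <= s <= 1 ->
  ((1 - s)%:E * poweR (mm_measure X C0) N%:R^-1
   + s%:E * poweR (mm_measure X C1) N%:R^-1
   <= poweR (mm_measure X (approx_intermediate h s C0 C1)) N%:R^-1)%E.

End BrunnMinkowski.

Section DistanceD.
Context {R : realType}.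

Definition pseudo_metric (T : Type) (d : T -> T -> R) : Prop :=
  [/\ forall x y, 0 <= d x y,
      forall x, d x x = 0,
      forall x y, d x y = d y x &
      forall x y z, d x z <= d x y + d y z].

Definition extends_metrics (X Y : metricType R) (d : X + Y -> X + Y -> R) :
    Prop :=
  (forall x x', d (inl x) (inl x') = mdist x x') /\
  (forall y y', d (inr y) (inr y') = mdist y y').

(* X and Y being separable, the product sigma-algebra carrying q is the Borel
   sigma-algebra of X * Y. *)
Definition coupling (X Y : mmspace R)
    (q : {measure set (borel X * borel Y) -> \bar R}) : Prop :=
  (forall A : set (borel X), measurable A -> q (A `*` setT) = mm_measure X A) /\
  (forall B : set (borel Y), measurable B -> q (setT `*` B) = mm_measure Y B).

(* The value is +oo when no coupling exists (different total masses). *)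
Definition mmdist (X Y : mmspace R) : \bar R :=
  ereal_inf [set v | exists (d : X + Y -> X + Y -> R)
      (q : {measure set (borel X * borel Y) -> \bar R}),
    [/\ pseudo_metric d, extends_metrics d, coupling q &
        v = poweR (\int[q]_z ((d (inl z.1) (inr z.2)) ^+ 2)%:E)%E 2^-1]].

End DistanceD.

(* Main.v *)
Require Import Defs.
From mathcomp Require Import all_boot all_order all_algebra.
From mathcomp Require Import all_classical all_reals all_analysis.
From mathcomp Require Import measurable_realfun ring lra.
Import Order.TTheory GRing.Theory Num.Theory.
Import numFieldNormedType.Exports.
Local Open Scope classical_set_scope.
Local Open Scope ring_scope.
Set Implicit Arguments.
Unset Strict Implicit.
Unset Printing Implicit Defensive.

(** The Brunn-Minkowski inequality passes to the limit because a coupling of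
small cost lets one carry sets back and forth between [Xn n] and [X] at a small
loss, both metrically and in measure.

Let [d] be a pseudo-metric on the disjoint union and [q] a coupling of the two
measures with small transport cost.  By the Markov inequality, the set of pairs
[(x, y)] with [e < d x y] has [q]-measure at most [k], where [e] is a fixed
scale and [k] is as small as desired ([mmdist_lt_coupling]).  Outside this bad
set, a point of one space is matched with an [e]-close point of the other, hence
[m B <= m' A + k] as soon as [A] contains every point matched with a point of
[B] ([coupling_le_l], [coupling_le_r]).

Given compact sets [C0] and [C1] of [X], the closed neighborhoods [A0] and [A1]
that they cut out in [Xn n] satisfy [m Ci <= m_n Ai + k]; the inequality
of [Xn n] bounds from below the measure of the set of approximate
intermediate points of [A0] and [A1]; and a point of [X] matched with such an
intermediate point is an intermediate point of [C0] and [C1] with an error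
larger by a multiple of [e].  Taking [N]-th roots, which are subadditive, gives
the inequality for [C0] and [C1] in [X] with [hn n + 10 * e] instead of [h] and
an additive loss [2 k^(1/N)] ([BM_transfer]).  Full support enters here: if
[m Ci = 0], it is the positive mass of the balls around a point of [Ci] that
makes [Ai] nonempty, so that the inequality of [Xn n] applies to it.

It remains to let [n] go to infinity, so that [k] goes to [0], and then [e] to
[0].  By compactness of [C0] and [C1], the sets of intermediate points with
error [h + 1/(j+1)] decrease to the one with error [h]
([approx_intermediate_closure]); since [m X] is finite, so do their measures
([approx_intermediate_cvg]). *)

(** * Subadditivity of roots *)

Lemma exprD_ge (R : realDomainType) (n : nat) (u v : R) :
  0 <= u -> 0 <= v -> u ^+ n.+1 + v ^+ n.+1 <= (u + v) ^+ n.+1.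
Proof.
move=> u0 v0; elim: n => [|n IHn]; first by rewrite !expr1.
rewrite (exprS (u + v)); apply: le_trans (ler_wpM2l (addr_ge0 u0 v0) IHn).
rewrite !exprS mulrDl !mulrDr.
have := mulr_ge0 u0 (mulr_ge0 v0 (exprn_ge0 n v0)).
have := mulr_ge0 v0 (mulr_ge0 u0 (exprn_ge0 n u0)).
lra.
Qed.

Lemma powR_root_expr (R : realType) (x : R) (n : nat) :
  0 <= x -> (x `^ n.+1%:R^-1) ^+ n.+1 = x.
Proof.
by move=> x0; rewrite -powR_mulrn ?powR_ge0// -powRrM mulVf ?powRr1//.
Qed.

Lemma powR_expr_root (R : realType) (x : R) (n : nat) :
  0 <= x -> (x ^+ n.+1) `^ n.+1%:R^-1 = x.
Proof.
by move=> x0; rewrite -powR_mulrn// -powRrM mulfV ?powRr1//.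
Qed.

(** Apply [exprD_ge] to the roots of [x] and [y]: the sum of the roots has a
power at least [x + y]. *)
Lemma powR_root_subadd (R : realType) (x y : R) (n : nat) :
  0 <= x -> 0 <= y ->
  (x + y) `^ n.+1%:R^-1 <= x `^ n.+1%:R^-1 + y `^ n.+1%:R^-1.
Proof.
move=> x0 y0; set p := n.+1%:R^-1.
have w0 : 0 <= x `^ p + y `^ p by rewrite addr_ge0 ?powR_ge0.
rewrite -[leRHS](@powR_expr_root _ _ n)//.
apply: ge0_ler_powR; rewrite ?nnegrE ?invr_ge0 ?(exprn_ge0 _ w0)
  ?(addr_ge0 x0 y0)//.
have := exprD_ge n (powR_ge0 x p) (powR_ge0 y p).
by rewrite !powR_root_expr.
Qed.

Lemma poweR_root_subadd (R : realType) (x y : \bar R) (n : nat) :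
  (0 <= x)%E -> (0 <= y)%E ->
  (poweR (x + y) n.+1%:R^-1 <= poweR x n.+1%:R^-1 + poweR y n.+1%:R^-1)%E.
Proof.
have p0 : n.+1%:R^-1 != 0 :> R by rewrite invr_eq0 pnatr_eq0.
have rN (z : \bar R) : poweR z n.+1%:R^-1 != -oo%E.
  by rewrite gt_eqF// (lt_le_trans _ (poweR_ge0 _ _)).
case: x => [x| |]// + ; case: y => [y| |]//.
- move=> y0 x0; rewrite -EFinD !poweR_EFin -EFinD lee_fin.
  by rewrite powR_root_subadd -?lee_fin.
- by move=> _ _; rewrite addey// poweRyr// addey ?leey.
- by move=> _ _; rewrite addye// poweRyr// addye ?leey.
- by move=> _ _; rewrite addye// poweRyr// addye ?leey.
Qed.

Lemma le_poweR (R : realType) (r : R) (x y : \bar R) :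
  (0 <= r)%R -> (0 <= x)%E -> (x <= y)%E -> (poweR x r <= poweR y r)%E.
Proof.
move=> r0 x0 xy; apply: gt0_ler_poweR => //.
  by rewrite in_itv /= x0 leey.
by rewrite in_itv /= (le_trans x0 xy) leey.
Qed.

(** * Approximate intermediate points *)

Lemma mdist_lipschitz (R : realFieldType) (X : metricType R) (x y x' y' : X) :
  `|mdist x y - mdist x' y'| <= mdist x x' + mdist y y'.
Proof.
rewrite ler_norml; apply/andP; split.
  have := metric_triangle x' x y'; have := metric_triangle x y y'.
  rewrite (metric_sym x' x); lra.
have := metric_triangle x x' y; have := metric_triangle x' y' y.
by rewrite (metric_sym y' y); lra.
Qed.

Lemma mdist_continuous2 (R : realType) (X : metricType R) :
  continuous (fun p : X * X => mdist p.1 p.2).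
Proof.
move=> [x y]; apply/cvgrPdist_le => /= e e0.
exists (ball x (e / 2), ball y (e / 2)) => /=.
  by split; apply: nbhsx_ballx; rewrite divr_gt0.
move=> [x' y'] /= []; rewrite !ballEmdist /= => xx' yy'.
by rewrite (le_trans (mdist_lipschitz _ _ _ _))// (splitr e) lerD// ltW.
Qed.

(** The two defects of a pair [(x0, x1)] at [x] depend continuously on the pair,
so their maximum attains its minimum over the compact set [C0 `*` C1].  The
hypothesis makes this minimum at most [h + 2 e] for every [e], and a minimizing
pair witnesses that [x] is intermediate.  This gives both that the set of
intermediate points is closed (constant error [h], [y] tending to [x]) and that
it is the intersection of those of larger error (constant [y = x]). *)
Lemma approx_intermediate_closure (R : realType) (X : metricType R) (h s : R)
    (C0 C1 : set X) (x : X) : compact C0 -> compact C1 ->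
  (forall e : R, 0 < e ->
     exists2 y, mdist y x <= e & approx_intermediate (h + e) s C0 C1 y) ->
  approx_intermediate h s C0 C1 x.
Proof.
move=> cC0 cC1 xlim.
pose f (p : X * X) : R := Num.max (`|mdist p.1 x - s * mdist p.1 p.2|)
   (`|mdist x p.2 - (1 - s) * mdist p.1 p.2|).
have cf : continuous f.
  have cd (a b : X * X -> X) : continuous a -> continuous b ->
      continuous (fun p => mdist (a p) (b p) : R).
    move=> ca cb p; apply: (@continuous_comp _ _ _ (fun p => (a p, b p))
      (fun p => mdist p.1 p.2)); last exact: mdist_continuous2.
    by apply: cvg_pair; [exact: ca|exact: cb].
  have cn (a b : X * X -> X) (t : R) : continuous a -> continuous b ->
      continuous (fun p => `|mdist (a p) (b p) - t * mdist p.1 p.2|).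
    move=> ca cb p; apply: (@continuous_comp _ _ _
      (fun p => mdist (a p) (b p) - t * mdist p.1 p.2 : R^o)
      (fun r : R^o => `|r|)); last exact: norm_continuous.
    apply: (@continuousB R R^o); first exact: cd.
    by apply: continuousM; [exact: cst_continuous|exact: mdist_continuous2].
  have cx : continuous (fun _ : X * X => x) by exact: cst_continuous.
  move=> p; apply: (continuous_max
    (f := fun p : X * X => `|mdist p.1 x - s * mdist p.1 p.2|)
    (g := fun p : X * X => `|mdist x p.2 - (1 - s) * mdist p.1 p.2|)).
    by apply: (cn fst (fun=> x)) => // q; exact: cvg_fst.
  by apply: (cn (fun=> x) snd) => // q; exact: cvg_snd.
have small e : 0 < e -> exists2 p, (C0 `*` C1) p & f p <= h + e + e.
  move=> e0; have [y xy [x0 [x1 [Cx0 Cx1 h0 h1]]]] := xlim e e0.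
  exists (x0, x1) => //; rewrite /f /= ge_max; apply/andP; split.
    have := mdist_lipschitz x0 x x0 y; rewrite mdistxx add0r (metric_sym x y).
    move: h0; rewrite !ler_norml => /andP[? ?] /andP[? ?].
    by apply/andP; split; lra.
  have := mdist_lipschitz x x1 y x1; rewrite mdistxx addr0 (metric_sym x y).
  move: h1; rewrite !ler_norml => /andP[? ?] /andP[? ?].
  by apply/andP; split; lra.
have C01 : C0 `*` C1 !=set0 by have [p Cp _] := small 1 ltr01; exists p.
have cwf : {within C0 `*` C1, continuous f} by exact: continuous_subspaceT.
have [[x0 x1] Cc cmin] := compact_EVT_min C01 (compact_setX cC0 cC1) cwf.
move: Cc; rewrite inE => -[/= Cx0 Cx1].
have : f (x0, x1) <= h.
  apply/ler_addgt0Pr => e e0; have e20 : 0 < e / 2 by rewrite divr_gt0.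
  have [p Cp fp] := small _ e20; apply: le_trans (cmin _ (mem_set Cp)) _.
  by rewrite (splitr e) addrA.
by rewrite /f ge_max /= => /andP[? ?]; exists x0, x1.
Qed.

Lemma approx_intermediateS (R : realType) (X : metricType R) (h h' s : R)
    (C0 C1 : set X) : h <= h' ->
  approx_intermediate h s C0 C1 `<=` approx_intermediate h' s C0 C1.
Proof.
move=> hh' x [x0 [x1 [? ? le0 le1]]].
by exists x0, x1; split => //; apply: le_trans hh'.
Qed.

Lemma closure_mdist (R : realType) (X : metricType R) (A : set X) (x : X)
    (e : R) :
  0 < e -> closure A x -> exists2 y, A y & mdist y x < e.
Proof.
move=> e0 /(_ _ (nbhsx_ballx x e e0))[y [Ay]]; rewrite ballEmdist /= => xy.
by exists y; rewrite // metric_sym.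
Qed.

Lemma approx_intermediate_closed (R : realType) (X : metricType R) (h s : R)
    (C0 C1 : set X) : compact C0 -> compact C1 ->
  closed (approx_intermediate h s C0 C1).
Proof.
move=> cC0 cC1 x clx; apply: approx_intermediate_closure => // e e0.
have [y Iy yx] := closure_mdist e0 clx.
exists y; first exact: ltW.
by apply: approx_intermediateS Iy; rewrite lerDl ltW.
Qed.

(** * Borel sets and finiteness of the measure *)

Lemma metric_ball_open (R : realFieldType) (X : metricType R) (x : X) (r : R) :
  open (ball x r).
Proof.
rewrite openE => y; rewrite ballEmdist /= => xy.
apply/nbhs_ballP; exists (r - mdist x y) => /=; first by rewrite subr_gt0.
move=> z; rewrite ballEmdist /= ltrBrDl; apply: le_lt_trans.
exact: metric_triangle.
Qed.

Lemma borel_open (T : ptopologicalType) (A : set (borel T)) :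
  open (A : set T) -> measurable A.
Proof. by move=> oA; exact: sub_sigma_algebra. Qed.

Lemma borel_closed (T : ptopologicalType) (A : set (borel T)) :
  closed (A : set T) -> measurable A.
Proof.
move=> /closed_openC oA; rewrite -(setCK A); apply: measurableC.
exact: borel_open.
Qed.

Lemma borel_compact (R : realType) (X : completeMetricType R)
    (A : set (borel X)) : compact (A : set X) -> measurable A.
Proof.
move=> cA; apply: borel_closed.
exact: (compact_closed (@metric_hausdorff R X) cA).
Qed.

Lemma borel_ball (R : realType) (X : completeMetricType R) (x : X) (r : R) :
  measurable (ball x r : set (borel X)).
Proof. by apply: borel_open; exact: metric_ball_open. Qed.

(** Finitely many balls of finite measure cover the space. *)
Lemma mm_measure_compact (R : realType) (X : mmspace R) :
  compact [set: X] -> (mm_measure X [set: X] < +oo)%E.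
Proof.
rewrite compact_cover => cX.
have /choice[r rP] : forall x : X, exists r : R,
    0 < r /\ (mm_measure X (ball x r) < +oo)%E.
  by move=> x; have [r r0 fr] := mm_locally_finite x; exists r.
have Xcover : [set: X] `<=` cover setT (fun x => ball x (r x)).
  by move=> x _; exists x => //; apply: ballxx; case: (rP x).
have [D _ XD] := cX X setT _ (fun x _ => metric_ball_open x (r x)) Xcover.
apply: le_lt_trans
  (content_sub_fsum (mm_measure X) (finite_fset D)
    (fun x _ => borel_ball x (r x)) measurableT XD) _.
rewrite fsbig_finite//=; apply: lte_sum_pinfty => x _.
by case: (rP x).
Qed.

(** * Couplings *)

(** Measures are compared through a coupling [q] up to an exceptional set [E]:
if every point of [A] has all its partners in [B] except for the pairs of [E],
then the cylinder over [A] is contained in the union of the cylinder over [B]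
and of [E]. *)
Section Couplings.
Context {R : realType} (X Y : mmspace R).
Context (q : {measure set (borel X * borel Y) -> \bar R}) (cq : coupling q).
Context (E : set (borel X * borel Y)) (mE : measurable E).

Lemma coupling_le_r (A : set (borel X)) (B : set (borel Y)) :
  measurable A -> measurable B ->
  (forall x y, A x -> ~ E (x, y) -> B y) ->
  (mm_measure X A <= mm_measure Y B + q E)%E.
Proof.
move=> mA mB AB; case: cq => <-// <-//.
have mAT : measurable (A `*` [set: borel Y]) by exact: measurableX.
have mTB : measurable ([set: borel X] `*` B) by exact: measurableX.
apply: le_trans (measureU2 _ mTB mE).
apply: le_measure; rewrite ?inE//; first exact: measurableU.
move=> [x y] [/= Ax _]; have [Exy|nE] := pselect (E (x, y)); first by right.
by left; split => //=; apply: AB nE.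
Qed.

Lemma coupling_le_l (A : set (borel X)) (B : set (borel Y)) :
  measurable A -> measurable B ->
  (forall x y, B y -> ~ E (x, y) -> A x) ->
  (mm_measure Y B <= mm_measure X A + q E)%E.
Proof.
move=> mA mB AB; case: cq => <-// <-//.
have mAT : measurable (A `*` [set: borel Y]) by exact: measurableX.
have mTB : measurable ([set: borel X] `*` B) by exact: measurableX.
apply: le_trans (measureU2 _ mAT mE).
apply: le_measure; rewrite ?inE//; first exact: measurableU.
move=> [x y] [/= _ By]; have [Exy|nE] := pselect (E (x, y)); first by right.
by left; split => //=; apply: AB nE.
Qed.

End Couplings.

Section CrossDistance.
Context {R : realType} (X Y : mmspace R) (d : X + Y -> X + Y -> R).
Hypotheses (pd : pseudo_metric d) (ed : extends_metrics d).

Lemma cross_dist_triangle_l (x x' : X) (y : Y) :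
  d (inl x) (inr y) <= mdist x x' + d (inl x') (inr y).
Proof. by case: pd ed => _ _ _ tri [<- _]. Qed.

Lemma cross_dist_triangle_r (x : X) (y y' : Y) :
  d (inl x) (inr y) <= d (inl x) (inr y') + mdist y' y.
Proof. by case: pd ed => _ _ _ tri [_ <-]. Qed.

(** This carries the distances that define intermediate points from one space to
the other. *)
Lemma cross_dist_quad (x x' : X) (y y' : Y) (a b : R) :
  d (inl x) (inr y) <= a -> d (inl x') (inr y') <= b ->
  `|mdist y y' - mdist x x'| <= a + b.
Proof.
case: pd ed => _ _ sym tri [dX dY] xy xy'; rewrite -dX -dY ler_norml.
have := tri (inr y) (inl x) (inr y'); have := tri (inl x) (inl x') (inr y').
have := tri (inl x) (inr y) (inl x'); have := tri (inr y) (inr y') (inl x').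
by rewrite (sym (inr y) (inl x)) (sym (inr y') (inl x')); lra.
Qed.

Lemma cross_dist_lt_open (y : Y) (c : R) :
  open [set x : X | c < d (inl x) (inr y)].
Proof.
rewrite openE => x /= cx; apply/nbhs_ballP.
exists (d (inl x) (inr y) - c) => /=; first by rewrite subr_gt0.
move=> x'; rewrite ballEmdist /= => xx'.
by have := cross_dist_triangle_l x x' y; lra.
Qed.

(** The distance between points of the two spaces is continuous, but the
sigma-algebra at hand is the product one, so openness of the superlevel sets
has to be turned into a countable union of measurable rectangles.  A dense
sequence [u] of the second space is enough: [c < d x y] means that, for some
[n] and [k], [y] is [1/(k+1)]-close to [u n] and [c + 1/(k+1) < d x (u n)]. *)
Lemma measurable_cross_dist :
  measurable_fun setT (fun z : borel X * borel Y => d (inl z.1) (inr z.2)).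
Proof.
have [S /pcard_surjP[u Su] dS] := mm_separable Y.
apply: (measurability _ (RGenOInfty.measurableE R)).
move=> _ [_ [c ->] <-]; rewrite setTI.
rewrite [X in measurable X](_ : _ = \bigcup_n \bigcup_k
  ([set x : X | c + k.+1%:R^-1 < d (inl x) (inr (u n))] `*`
   ball (u n) k.+1%:R^-1)).
  apply: bigcupT_measurable => n; apply: bigcupT_measurable => k.
  apply: measurableX; last exact: borel_ball.
  by apply: borel_open; exact: cross_dist_lt_open.
have dense_gt (x : X) (y : Y) : c < d (inl x) (inr y) -> exists n k,
    c + k.+1%:R^-1 < d (inl x) (inr (u n)) /\ mdist (u n) y < k.+1%:R^-1.
  move=> cxy; have e0 : 0 < (d (inl x) (inr y) - c) / 2 by lra.
  have [k] := ltr_add_invr e0; rewrite add0r => ke.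
  have k0 : 0 < k.+1%:R^-1 :> R by rewrite invr_gt0.
  have [z [yz Sz]] : ball y k.+1%:R^-1 `&` S !=set0.
    by apply: dS; [exists y; exact: ballxx|exact: metric_ball_open].
  have [n _ unz] := Su _ Sz; exists n, k.
  rewrite unz; move: yz; rewrite ballEmdist /= metric_sym => zy.
  have arith (a b D D' : R) : a < (D - c) / 2 -> b < a -> D <= D' + b ->
      c + a < D' by lra.
  by split => //; exact: arith ke zy (cross_dist_triangle_r _ _ _).
have gt_dense (x : X) (y : Y) n k :
    c + k.+1%:R^-1 < d (inl x) (inr (u n)) -> mdist (u n) y < k.+1%:R^-1 ->
    c < d (inl x) (inr y).
  have arith (a b D D' : R) : c + a < D' -> b < a -> D' <= D + b -> c < D.
    by lra.
  move=> cxu uy; apply: arith cxu uy _; rewrite metric_sym.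
  exact: cross_dist_triangle_r.
apply/seteqP; split => [[x y]|[x y] [n _] [k _]] /=; rewrite in_itv /= andbT.
  move=> /dense_gt[n [k [? ?]]]; exists n => //; exists k => //=.
  by rewrite ballEmdist.
by rewrite ballEmdist => -[]; exact: gt_dense.
Qed.

Lemma measurable_cross_dist_gt (e : R) :
  measurable [set z : borel X * borel Y | e < d (inl z.1) (inr z.2)].
Proof.
have := measurable_cross_dist measurableT (measurable_itv `]e, +oo[).
rewrite setTI; congr measurable.
by apply/seteqP; split => z /=; rewrite in_itv /= andbT.
Qed.

Lemma cross_dist_markov (q : {measure set (borel X * borel Y) -> \bar R})
    (e : R) : 0 <= e ->
  ((e ^+ 2)%:E * q [set z | (e < d (inl z.1) (inr z.2))%R] <=
   \int[q]_z ((d (inl z.1) (inr z.2)) ^+ 2)%:E)%E.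
Proof.
move=> e0; have mE := measurable_cross_dist_gt e.
have md2 : measurable_fun setT (fun z : borel X * borel Y =>
    ((d (inl z.1) (inr z.2)) ^+ 2)%:E).
  by apply/measurable_EFinP/measurable_funX; exact: measurable_cross_dist.
rewrite -integral_cst//.
apply: (@le_trans _ _ (\int[q]_(z in [set z | (e < d (inl z.1) (inr z.2))%R])
    ((d (inl z.1) (inr z.2)) ^+ 2)%:E)%E).
  apply: ge0_le_integral => //.
  - by move=> z _; rewrite lee_fin sqr_ge0.
  - exact: measurable_funTS.
  - move=> z /= /ltW ez; rewrite lee_fin ler_sqr ?nnegrE//.
    exact: le_trans ez.
apply: ge0_subset_integral => //.
by move=> z _; rewrite lee_fin sqr_ge0.
Qed.

End CrossDistance.

(** The cost, being below [(e * k) ^+ 2], bounds [e ^+ 2] times the measure of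
the set of [e]-far pairs. *)
Lemma mmdist_lt_coupling (R : realType) (X Y : mmspace R) (e k : R) :
  0 < e -> 0 < k -> (mmdist X Y < (e * k)%:E)%E ->
  exists (d : X + Y -> X + Y -> R)
    (q : {measure set (borel X * borel Y) -> \bar R}),
  [/\ pseudo_metric d, extends_metrics d, coupling q &
     (q [set z | (e < d (inl z.1) (inr z.2))%R] <= (k ^+ 2)%:E)%E].
Proof.
move=> e0 k0 /ereal_inf_lt[_ [d [q [pd ed cq ->]]] lt_ek].
exists d, q; split => //.
have := cross_dist_markov pd ed q (ltW e0).
set I := (\int[q]_z _)%E in lt_ek *; set E := [set z | _] => mark.
have I0 : (0 <= I)%E.
  by apply: integral_ge0 => z _; rewrite lee_fin sqr_ge0.
have IE : poweR (poweR I 2^-1) 2 = I.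
  by rewrite -poweRrM mulVf ?poweRe1// pnatr_eq0.
have : (I <= ((e * k) ^+ 2)%:E)%E.
  rewrite -IE -powR_mulrn ?mulr_ge0 ?(ltW e0) ?(ltW k0)// -poweR_EFin.
  by apply: le_poweR; rewrite ?poweR_ge0 ?(ltW lt_ek).
move=> /(le_trans mark); rewrite exprMn (EFinM (e ^+ 2)).
by rewrite lee_pmul2l// lte_fin exprn_gt0.
Qed.

(** * Transfer of the inequality along a coupling *)

Lemma ler_norm_convex_comb (R : realDomainType) (t a b a0 b0 h u v : R) :
  0 <= t <= 1 -> `|a0 - t * a| <= h -> `|b0 - a0| <= u -> `|b - a| <= v ->
  `|b0 - t * b| <= h + u + v.
Proof.
move=> /andP[t0 t1] le_h le_u le_v.
have -> : b0 - t * b = (a0 - t * a) + (b0 - a0) - t * (b - a) by ring.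
rewrite (le_trans (ler_normB _ _))// lerD//.
  by rewrite (le_trans (ler_normD _ _))// lerD.
by rewrite normrM ger0_norm// (le_trans _ le_v)// ler_piMl.
Qed.

Section Transfer.
Context {R : realType} (X Y : mmspace R).
Context (d : X + Y -> X + Y -> R).
Context (q : {measure set (borel X * borel Y) -> \bar R}).
Hypotheses (pd : pseudo_metric d) (ed : extends_metrics d) (cq : coupling q).
Context (e k : R).
Hypotheses (e0 : 0 < e) (k0 : 0 <= k).
Hypothesis far : (q [set z | (e < d (inl z.1) (inr z.2))%R] <= k%:E)%E.

(** The closure makes the set compact when [X] is.  The radius is [2 e] and not
[e] so that every [x] which is [e]-close to some point of the [e]-ball around a
point of [C] belongs to it; this is what [neighborhood_nonempty] uses. *)
Definition neighborhood (C : set Y) : set X :=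
  closure [set x | exists2 y, C y & d (inl x) (inr y) <= e + e].

Lemma neighborhood_near (C : set Y) (x : X) :
  neighborhood C x -> exists2 y, C y & d (inl x) (inr y) <= e + e + e.
Proof.
move=> /(closure_mdist e0)[x' [y Cy x'y] x'x]; exists y => //.
have := cross_dist_triangle_l pd ed x x' y; rewrite metric_sym; lra.
Qed.

(** If no point of [X] were close to [c], the cylinder over the ball around [c]
would consist of far pairs, whose measure is at most [k]. *)
Lemma neighborhood_nonempty (C : set Y) (c : Y) :
  C c -> (k%:E < mm_measure Y (ball c e))%E -> neighborhood C !=set0.
Proof.
move=> Cc kc; apply: contrapT => N0.
have : (mm_measure Y (ball c e) <=
    mm_measure X set0 + q [set z | (e < d (inl z.1) (inr z.2))%R])%E.
  apply: coupling_le_l => //; first exact: measurable_cross_dist_gt.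
    exact: borel_ball.
  move=> x y; rewrite ballEmdist /= => cy /negP; rewrite -leNgt => xy.
  apply: N0; exists x; apply: subset_closure; exists c => //.
  by have := cross_dist_triangle_r pd ed x c y; rewrite metric_sym; lra.
rewrite measure0 add0e => /le_trans/(_ far).
by rewrite leNgt kc.
Qed.

Lemma neighborhood_measure (C : set Y) : compact C ->
  (mm_measure Y C <= mm_measure X (neighborhood C) + k%:E)%E.
Proof.
move=> cC; apply: (le_trans (coupling_le_l cq
    (measurable_cross_dist_gt pd ed e) _ _ _)); last exact: leeD2l far.
- by apply: borel_closed; exact: closed_closure.
- exact: borel_compact.
move=> x y Cy /negP; rewrite -leNgt => xy; apply: subset_closure.
by exists y => //; rewrite (le_trans xy)// lerDl ltW.
Qed.

(** Each endpoint moves by at most [3 e] and the intermediate point by at most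
[e], so the distances to the intermediate point change by at most [4 e] and the
distance between the endpoints by at most [6 e]. *)
Lemma approx_intermediate_neighborhood (h s : R) (C0 C1 : set Y)
    (x : X) (y : Y) :
  0 <= s <= 1 -> d (inl x) (inr y) <= e ->
  approx_intermediate h s (neighborhood C0) (neighborhood C1) x ->
  approx_intermediate (h + 10 * e) s C0 C1 y.
Proof.
move=> /andP[s0 s1] xy [x0 [x1 [/neighborhood_near[y0 Cy0 x0y0]
  /neighborhood_near[y1 Cy1 x1y1] le0 le1]]].
exists y0, y1; split => //.
- apply: le_trans (ler_norm_convex_comb _ le0 (cross_dist_quad pd ed x0y0 xy)
    (cross_dist_quad pd ed x0y0 x1y1)) _; first by rewrite s0.
  lra.
- apply: le_trans (ler_norm_convex_comb _ le1 (cross_dist_quad pd ed xy x1y1)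
    (cross_dist_quad pd ed x0y0 x1y1)) _; first by rewrite subr_ge0 s1 /=; lra.
  lra.
Qed.

(** Each of the three measures costs one root of [k] when it is carried to the
other space; those of [C0] and [C1] are weighted by [1 - s] and [s], hence two
roots in total. *)
Lemma BM_transfer (n : nat) (h s : R) (C0 C1 : set Y) (c0 c1 : Y) :
  compact [set: X] -> BM X n.+1 h -> compact C0 -> compact C1 ->
  C0 c0 -> C1 c1 ->
  (k%:E < mm_measure Y (ball c0 e))%E -> (k%:E < mm_measure Y (ball c1 e))%E ->
  0 <= s <= 1 ->
  ((1 - s)%:E * poweR (mm_measure Y C0) n.+1%:R^-1
   + s%:E * poweR (mm_measure Y C1) n.+1%:R^-1
   <= poweR (mm_measure Y (approx_intermediate (h + 10 * e) s C0 C1)) n.+1%:R^-1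
      + (k `^ n.+1%:R^-1 + k `^ n.+1%:R^-1)%:E)%E.
Proof.
move=> cX BMX cC0 cC1 Cc0 Cc1 kc0 kc1 s01.
set p := n.+1%:R^-1.
have cN C : compact (neighborhood C).
  by apply: (subclosed_compact _ cX) => //; exact: closed_closure.
have root_le (a b : \bar R) : (0 <= a)%E -> (0 <= b)%E ->
    (a <= b + k%:E)%E -> (poweR a p <= poweR b p + (k `^ p)%:E)%E.
  move=> a0 b0 ab; rewrite -poweR_EFin.
  apply: le_trans (poweR_root_subadd n b0 _); last by rewrite lee_fin.
  by apply: le_poweR => //; rewrite invr_ge0.
have rootC C : compact C -> (poweR (mm_measure Y C) p <=
    poweR (mm_measure X (neighborhood C)) p + (k `^ p)%:E)%E.
  by move=> cC; apply: root_le; rewrite ?measure_ge0//;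
    exact: neighborhood_measure.
have := BMX _ _ (cN C0) (cN C1) (neighborhood_nonempty Cc0 kc0)
  (neighborhood_nonempty Cc1 kc1) s s01.
rewrite -/p; set IX := approx_intermediate h _ _ _.
set IY := approx_intermediate _ _ C0 C1 => BMN.
have rootI : (poweR (mm_measure X IX) p <=
    poweR (mm_measure Y IY) p + (k `^ p)%:E)%E.
  apply: root_le; rewrite ?measure_ge0//.
  apply: (le_trans (coupling_le_r cq (measurable_cross_dist_gt pd ed e) _ _ _));
    last exact: leeD2l far.
  - by apply: borel_closed; exact: approx_intermediate_closed.
  - by apply: borel_closed; exact: approx_intermediate_closed.
  - move=> x y Ix /negP; rewrite -leNgt => xy.
    exact: approx_intermediate_neighborhood Ix.
have /andP[s0 s1] := s01.
have s0' : 0 <= 1 - s by rewrite subr_ge0.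
rewrite (EFinD (k `^ p)) addeA; apply: le_trans (leeD2r _ rootI).
apply: le_trans (leeD2r _ BMN).
apply: le_trans (leeD (lee_wpmul2l _ (rootC _ cC0))
  (lee_wpmul2l _ (rootC _ cC1))) _; rewrite ?lee_fin//.
rewrite !ge0_muleDr ?poweR_ge0 ?lee_fin ?powR_ge0// addeACA leeD2l//.
by rewrite -!EFinM -EFinD lee_fin -mulrDl subrK mul1r.
Qed.

End Transfer.

(** * Passage to the limit *)

(** Continuity from above of the finite measure of [X]. *)
Lemma approx_intermediate_cvg (R : realType) (X : mmspace R) (h s : R)
    (C0 C1 : set X) : compact [set: X] -> compact C0 -> compact C1 ->
  (fun n : nat => mm_measure X (approx_intermediate (h + n.+1%:R^-1) s C0 C1))
    @ \oo --> mm_measure X (approx_intermediate h s C0 C1).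
Proof.
move=> cX cC0 cC1.
have mI t : measurable (approx_intermediate t s C0 C1 : set (borel X)).
  by apply: borel_closed; exact: approx_intermediate_closed.
have -> : approx_intermediate h s C0 C1 =
    \bigcap_n approx_intermediate (h + n.+1%:R^-1) s C0 C1.
  apply/seteqP; split => [x Ix n _|x Ix].
    by apply: approx_intermediateS Ix; rewrite lerDl invr_ge0.
  apply: approx_intermediate_closure => // e e0; exists x.
    by rewrite mdistxx ltW.
  have [n] := ltr_add_invr e0; rewrite add0r => ne.
  by apply: approx_intermediateS (Ix n I); rewrite lerD2l ltW.
apply: nonincreasing_cvg_mu => //.
- apply: le_lt_trans (mm_measure_compact cX).
  by apply: le_measure; rewrite ?inE.
- exact: bigcap_measurable.
- move=> m n mn; apply/subsetPset/approx_intermediateS.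
  by rewrite lerD2l lef_pV2 ?posrE// ler_nat ltnS.
Qed.

Lemma ereal_gt0_real (R : realType) (a : \bar R) : (0 < a)%E ->
  exists2 r : R, 0 < r & (r%:E < a)%E.
Proof.
case: a => [a| |]//; last by move=> _; exists 1; rewrite ?ltry.
by rewrite lte_fin => a0; exists (a / 2); rewrite ?lte_fin; lra.
Qed.

Theorem theorem2p3 (R : realType) (N : nat) (hN : (1 <= N)%N)
    (Xn : nat -> mmspace R) (X : mmspace R)
    (Xn_compact : forall n, compact [set: Xn n]) (X_compact : compact [set: X])
    (Xn_cvg : (fun n => mmdist (Xn n) X) @ \oo --> 0%E)
    (hn : nat -> R) (h : R)
    (hn_ge0 : forall n, 0 <= hn n) (hn_cvg : hn @ \oo --> h)
    (Xn_BM : forall n, BM (Xn n) N (hn n)) :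
  BM X N h.
Proof.
case: N hN Xn_BM => // N _ Xn_BM C0 C1 cC0 cC1 [c0 Cc0] [c1 Cc1] s s01.
apply/lee_addgt0Pr => t0 t0_gt0; set p := N.+1%:R^-1.
(* one third of the slack for each [N]-th root lost below *)
pose t : R := t0 / 3; have t_gt0 : 0 < t by rewrite /t; lra.
have t_root : (t ^+ N.+1) `^ p = t by apply: powR_expr_root; exact: ltW.
have tN0 : 0 < t ^+ N.+1 by exact: exprn_gt0.
set I := approx_intermediate h s C0 C1.
have mI r : measurable (approx_intermediate r s C0 C1 : set (borel X)).
  by apply: borel_closed; exact: approx_intermediate_closed.
have Ifin : mm_measure X I \is a fin_num.
  rewrite ge0_fin_numE ?measure_ge0//.
  apply: le_lt_trans (mm_measure_compact X_compact).
  by apply: le_measure; rewrite ?inE//; exact: mI.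
have [j Ij] : exists j : nat,
    (mm_measure X (approx_intermediate (h + j.+1%:R^-1) s C0 C1) <
     mm_measure X I + (t ^+ N.+1)%:E)%E.
  have It : (mm_measure X I < mm_measure X I + (t ^+ N.+1)%:E)%E.
    by rewrite lteDl// lte_fin.
  have [j _ jP] := approx_intermediate_cvg (h := h) (s := s) X_compact cC0 cC1
    (open_ereal_lt' It).
  by exists j; exact: (jP j (leqnn j)).
(* [hn n + 10 * e <= h + 11 * e] for large [n] *)
pose e : R := j.+1%:R^-1 / 11.
have e0 : 0 < e by rewrite divr_gt0// invr_gt0.
have [r0 r0_gt0 r0c] := ereal_gt0_real (mm_full_support c0 e0).
have [r1 r1_gt0 r1c] := ereal_gt0_real (mm_full_support c1 e0).
(* [k] below the mass of the two balls makes the neighborhoods of [C0] and [C1]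
   nonempty; the bound drawn from the cost squares its second factor, hence the
   square root of [k] below *)
pose k := Num.min (t ^+ N.+1) (Num.min r0 r1).
have k0 : 0 < k by rewrite !lt_min tN0 r0_gt0.
have kt : k `^ p <= t.
  rewrite -[leRHS]t_root; apply: ge0_ler_powR;
    rewrite ?nnegrE ?invr_ge0 ?(ltW k0) ?(ltW tN0)//.
  by rewrite ge_min lexx.
have kc0 : (k%:E < mm_measure X (ball c0 e))%E.
  by apply: le_lt_trans r0c; rewrite lee_fin !ge_min lexx orbT.
have kc1 : (k%:E < mm_measure X (ball c1 e))%E.
  by apply: le_lt_trans r1c; rewrite lee_fin !ge_min lexx !orbT.
have ek0 : (0 < (e * Num.sqrt k)%:E)%E.
  by rewrite lte_fin mulr_gt0// sqrtr_gt0.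
have [n [nclose nh]] : exists n : nat,
    (mmdist (Xn n) X < (e * Num.sqrt k)%:E)%E /\ hn n <= h + e.
  have [n1 _ n1P] := Xn_cvg _ (open_ereal_lt' ek0).
  have he : h < h + e by rewrite ltrDl.
  have [n2 _ n2P] := hn_cvg _ (lt_nbhsl he).
  exists (maxn n1 n2); split; first by apply: n1P; exact: leq_maxl.
  by apply/ltW/n2P; exact: leq_maxr.
have sk0 : 0 < Num.sqrt k by rewrite sqrtr_gt0.
have [d [q [pd ed cq]]] := mmdist_lt_coupling e0 sk0 nclose.
rewrite (sqr_sqrtr (ltW k0)) => far.
apply: le_trans (BM_transfer pd ed cq e0 (ltW k0) far (Xn_compact n) (Xn_BM n)
  cC0 cC1 Cc0 Cc1 kc0 kc1 s01) _.
have Imono : (mm_measure X (approx_intermediate (hn n + 10 * e) s C0 C1) <=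
    mm_measure X I + (t ^+ N.+1)%:E)%E.
  apply: le_trans (ltW Ij); apply: le_measure; rewrite ?inE//.
  have arith (a r : R) : a <= h + r / 11 -> a + 10 * (r / 11) <= h + r by lra.
  exact/approx_intermediateS/arith.
have Iroot :
    (poweR (mm_measure X (approx_intermediate (hn n + 10 * e) s C0 C1)) p <=
    poweR (mm_measure X I) p + t%:E)%E.
  rewrite -[t in leRHS]t_root -poweR_EFin.
  apply: le_trans (poweR_root_subadd N _ _);
    rewrite ?measure_ge0 ?lee_fin ?(ltW tN0)//.
  by apply: le_poweR; rewrite ?invr_ge0 ?measure_ge0.
apply: le_trans (leeD2r _ Iroot) _; rewrite -addeA leeD2l// -EFinD lee_fin.
by rewrite /t in kt *; lra.
Qed.
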